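(* On every instance $I=\langle \mathcal{N},\mathcal{R},L,\pi^0\rangle$ with $n$ agents and $n$ resources that is single-peaked with respect to a (known) axis $\lhd$, the Diver procedure always terminates, runs in time $\mathcal{O}(n)$, and returns whether the initial allocation $\pi^0$ is Pareto-optimal or not (i.e. it returns ''PO'' if $\pi^0$ is Pareto-optimal and ''not PO'' otherwise).
   Context: Setting. $\mathcal{N}=\{a_1,\dots,a_n\}$ is a set of $n$ agents and $\mathcal{R}=\{r_1,\dots,r_n\}$ a set of $n$ resources. An allocation $\pi=\langle \pi_{a_1},\dots,\pi_{a_n}\rangle$ assigns to each agent $a_i$ a single resource $\pi_{a_i}\in\mathcal{R}$, distinct agents getting distinct resources (so it is a bijection). Each agent $a_i$ has a strict linear order $\succ_i$ over $\mathcal{R}$; $L=\langle\succ_i\rangle_{a_i\in\mathcal{N}}$ is the preference profile. An instance is $I=\langle\mathcal{N},\mathcal{R},L,\pi^0\rangle$ with $\pi^0$ an initial allocation. For $R\subseteq\mathcal{R}$, $top_R(a_i)$ is the $\succ_i$-most preferred resource in $R$; $top(\succ)$ is the top resource of $\succ$ in $\mathcal{R}$. Single-peakedness. Given a linear order (axis) $\lhd$ on $\mathcal{R}$, a linear order $\succ$ on $\mathcal{R}$ is single-peaked with respect to $\lhd$ if for all $r,r'\in\mathcal{R}$ with $r'\lhd r\lhd top(\succ)$ or $top(\succ)\lhd r\lhd r'$ one has $r\succ r'$. The instance is single-peaked with respect to $\lhd$ if all $\succ_i$ are. Pareto-optimality. $\pi$ is Pareto-optimal if there is no allocation $\pi'$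 such that every agent $a_i$ has $\pi'_{a_i}\succ_i\pi_{a_i}$ or $\pi'_{a_i}=\pi_{a_i}$, and at least one agent $a_j$ has $\pi'_{a_j}\succ_j\pi_{a_j}$. The Diver procedure. Sort the agents from left to right along $\lhd$ according to the resource they hold in $\pi^0$; relabel so that the $i$-th agent in this order is $a_i$, holding $r_i$, with $r_1\lhd\dots\lhd r_n$. Let $R$ denote the set of remaining (not yet picked) resources, initially $R=\mathcal{R}$, and let $D$ be an initially empty list. ''Agent $a_i$ picks $r_i$'' means that $a_i$ leaves the procedure with $r_i$, and $r_i$ is removed from $R$ (and $a_i$ from $D$ if she is in it). For $i=1,\dots,n$ in turn: (1) If $top_R(a_i)=r_i$: $a_i$ picks $r_i$. Then go through the agents $a_j$ of $D$ in reverse order (last appended first): if $r_j\succ_j r_{i+1}$, then $a_j$ picks $r_j$ and is removed from $D$, and the backward loop continues; otherwise the backward loop stops. When $i=n$ there is no resource $r_{n+1}$ and the condition $r_j\succ_j r_{n+1}$ is regarded as true. (2) Else, if $r_i\succ_i r_{i+1}$ (regarded as true if $i=n$), i.e. $top_R(a_i)$ is to the left of $r_i$: stop and return ''not PO''. (3) Else ($top_R(a_i)$ is to the right of $r_i$): append $a_i$ at the end of $D$ (she ''passes''). If the loop over $i$ ends without having returned, return ''PO''. Running time is counted in elementary operations; comparing two given resources in a given agent's preference order counts as one elementary operation. The axis is given as an ordered list of the resources. *)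

(* Defs.v *)
From HB Require Import structures.
From mathcomp Require Import all_boot all_fingroup.

Set Implicit Arguments.
Unset Strict Implicit.
Unset Printing Implicit Defensive.

Definition strict_linear_order (T : eqType) (r : rel T) : Prop :=
  [/\ irreflexive r, transitive r & forall x y, x != y -> r x y || r y x].

(* [t = top_S] for the order [succ]. *)
Definition is_top (T : finType) (succ : rel T) (S : {set T}) (t : T) : bool :=
  (t \in S) && [forall (s | s \in S), (s != t) ==> succ t s].

Definition single_peaked (T : finType) (lhd succ : rel T) : Prop :=
  forall t r r' : T, is_top succ setT t ->
    (lhd r' r /\ lhd r t) \/ (lhd t r /\ lhd r r') -> succ r r'.

(* Both the n agents and the n resources are numbered by 'I_n; an allocation
   maps agents to resources injectively, hence is a permutation of 'I_n. *)
Notation agent n := 'I_n (only parsing).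
Notation resource n := 'I_n (only parsing).
Notation allocation n := {perm 'I_n} (only parsing).

Record instance (n : nat) := Instance {
  pref : agent n -> rel (resource n);
  init : allocation n;
  pref_linear : forall a, strict_linear_order (pref a)
}.

Definition single_peaked_instance n (lhd : rel (resource n)) (I : instance n) :=
  forall a, single_peaked lhd (pref I a).

Definition pareto_optimal n (I : instance n) (pi : allocation n) : Prop :=
  ~ exists pi' : allocation n,
      (forall a, pref I a (pi' a) (pi a) \/ pi' a = pi a) /\
      (exists a, pref I a (pi' a) (pi a)).

Inductive verdict := PO | NotPO.

(* The visible actions of the procedure: an agent leaves with a resource, or
   passes (i.e. is appended to D). *)
Inductive event := Pick (a r : nat) | Pass (a : nat).

Section Diver.

Variables (n : nat) (I : instance n).

(* [Visit s]: the agents of [s] = [a_i; ...; a_n] are still to be considered.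
   [Backward s]: backward loop through D, where [s] = [a_(i+1); ...; a_n].
   R is the set of remaining resources and D is listed from the agent appended
   last to the agent appended first. *)
Inductive diver_state :=
| Visit of seq (agent n) & {set resource n} & seq (agent n) & seq event
| Backward of seq (agent n) & {set resource n} & seq (agent n) & seq event
| Returned of seq event & verdict.

(* [r >_a r_(i+1)], where [s] = [a_(i+1); ...; a_n]; true if i = n. *)
Definition beats_next (a : agent n) (r : resource n) (s : seq (agent n)) :=
  if s is b :: _ then pref I a r (init I b) else true.

Definition diver_step (st : diver_state) : diver_state :=
  match st with
  | Visit [::] R D lg => Returned lg PO
  | Visit (a :: s) R D lg =>
      let r := init I a in
      if is_top (pref I a) R r then
        Backward s (R :\ r) D (rcons lg (Pick a r))
      else if beats_next a r s then Returned lg NotPO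
      else Visit s R (a :: D) (rcons lg (Pass a))
  | Backward s R [::] lg => Visit s R [::] lg
  | Backward s R (b :: D) lg =>
      let r := init I b in
      if beats_next b r s then Backward s (R :\ r) D (rcons lg (Pick b r))
      else Visit s R (b :: D) lg
  | Returned lg v => Returned lg v
  end.

Variable lhd : rel (resource n).

Definition axis_le : rel (resource n) := fun r s => (r == s) || lhd r s.

Definition diver_start : diver_state :=
  Visit (sort (fun a b => axis_le (init I a) (init I b)) (enum 'I_n))
        setT [::] [::].

Definition diver_returns (lg : seq event) (v : verdict) : Prop :=
  exists k, iter k diver_step diver_start = Returned lg v.

End Diver.

(* A random access machine with unit-cost instructions. A program uses finitely
   many registers and arrays, named by constants; arrays are indexed by the
   contents of registers. The arithmetic is limited to increment, decrement and
   comparison, so a word never exceeds the size of the input plus the running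
   time plus the constants of the program. The preferences are only accessible
   through [Prefers x a r s], which stores in register x the outcome of
   comparing the resources in registers r and s for the agent in register a.
   [EmitPick] and [EmitPass] perform an [event]; they do not influence the rest
   of the run. *)
Inductive instr :=
| Const (x k : nat)
| Copy (x y : nat)
| Incr (x : nat)
| Decr (x : nat)
| Less (x y z : nat)
| Fetch (x A i : nat)
| Store (A i x : nat)
| Prefers (x a r s : nat)
| EmitPick (a r : nat)
| EmitPass (a : nat)
| If (x : nat) (p q : seq instr)
| While (x : nat) (p : seq instr)
| Return (v : verdict).

Definition program := seq instr.

(* [Running p regs arrs lg]: the instructions [p] remain to be executed. *)
Inductive ram_state :=
| Running of program & (nat -> nat) & (nat -> nat -> nat) & seq event
| Halted of seq event & verdict.

Definition upd (T : Type) (f : nat -> T) (k : nat) (v : T) : nat -> T :=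
  fun j => if j == k then v else f j.

Definition ram_step (prefers : nat -> nat -> nat -> bool) (st : ram_state) :
    ram_state :=
  match st with
  | Running [::] g m lg => st
  | Running (c :: p) g m lg =>
      match c with
      | Const x k => Running p (upd g x k) m lg
      | Copy x y => Running p (upd g x (g y)) m lg
      | Incr x => Running p (upd g x ((g x).+1)) m lg
      | Decr x => Running p (upd g x ((g x).-1)) m lg
      | Less x y z => Running p (upd g x (nat_of_bool (g y < g z))) m lg
      | Fetch x A i => Running p (upd g x (m A (g i))) m lg
      | Store A i x =>
          Running p g (upd m A (upd (m A) (g i) (g x))) lg
      | Prefers x a r s =>
          Running p (upd g x (nat_of_bool (prefers (g a) (g r) (g s))))
            m lg
      | EmitPick a r => Running p g m (rcons lg (Pick (g a) (g r)))
      | EmitPass a => Running p g m (rcons lg (Pass (g a)))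
      | If x q1 q2 => Running ((if g x != 0 then q1 else q2) ++ p) g m lg
      | While x q =>
          Running (if g x != 0 then q ++ While x q :: p else p) g m lg
      | Return v => Halted lg v
      end
  | Halted _ _ => st
  end.

(* Comparisons involving a number that is not below n come out false. *)
Definition prefers_nat n (I : instance n) (a r s : nat) : bool :=
  if (insub a, insub r, insub s) is (Some a', Some r', Some s')
  then pref I a' r' s' else false.

(* Input: register 0 holds n, array 0 is the axis as the list of the resources
   from left to right, array 1 gives the resource initially held by each agent;
   everything else is 0. *)
Definition ram_start n (I : instance n) (lhd : rel (resource n)) (p : program) :=
  Running p
    (upd (fun=> 0) 0 n)
    (fun A => match A with
              | 0 => nth 0 [seq val r | r <- sort (axis_le lhd) (enum 'I_n)]
              | 1 => nth 0 [seq val (init I a) | a <- enum 'I_n]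
              | _ => fun=> 0
              end)
    [::].

(* On input (I, lhd), the program [p] halts after at most t elementary
   operations, having performed the events [lg] and returned [v]. *)
Definition ram_returns_in n (I : instance n) (lhd : rel (resource n))
    (p : program) (t : nat) (lg : seq event) (v : verdict) : Prop :=
  iter t (ram_step (prefers_nat I)) (ram_start I lhd p) = Halted lg v.

(* Main.v *)
Require Import Defs.
From HB Require Import structures.
From mathcomp Require Import all_boot all_fingroup.
From mathcomp Require Import zify.

(** Single-peaked preferences have no valley along the axis, so the best
remaining resource of an agent is her own iff it beats its two neighbours among
the remaining ones: the resource of the last agent of D and the next one on the
axis. Hence each test of the procedure costs at most two comparisons, and a
linear potential (the agents still to be visited plus those in D) bounds their
number.
Agents who leave take their best remaining resource, so by induction no
dominating allocation changes what they hold. If the procedure rejects at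
[a_i], she prefers the resource of the last agent of D, who in turn prefers
[r_i] to her own: swapping the two is a Pareto improvement. *)

Set Implicit Arguments.
Unset Strict Implicit.
Unset Printing Implicit Defensive.

(** * Strict linear orders and their tops *)

Lemma strict_asym (T : eqType) (r : rel T) x y :
  strict_linear_order r -> r x y -> ~~ r y x.
Proof. by case=> irr tr _ xy; apply/negP=> /(tr _ _ _ xy); rewrite irr. Qed.

Lemma strict_neq (T : eqType) (r : rel T) x y :
  strict_linear_order r -> r x y -> x != y.
Proof. by case=> irr _ _; apply: contraTneq => ->; rewrite irr. Qed.

Lemma strictN (T : eqType) (r : rel T) x y :
  strict_linear_order r -> x != y -> ~~ r x y = r y x.
Proof.
move=> lin neq; apply/idP/idP => [nxy|/(strict_asym lin)//].
by case: lin => _ _ /(_ _ _ neq); rewrite (negbTE nxy).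
Qed.

(** An element that beats the most others works: anything above it would beat all of these and the
    element itself. *)
Lemma ex_top (T : finType) (succ : rel T) (x : T) :
  strict_linear_order succ -> exists t, is_top succ setT t.
Proof.
move=> lin; have [_ tr _] := lin.
have [t _ tmax] := @arg_maxnP _ x predT (fun t => #|[set s | succ t s]|) isT.
exists t; rewrite /is_top inE; apply/forall_inP => s _; apply/implyP => st.
apply: contraT; rewrite strictN // 1?eq_sym // => s_t.
have /= := tmax s isT; rewrite leqNgt => /negP[]; apply: proper_card.
apply/properP; split; first by apply/subsetP=> y; rewrite !inE; apply: tr.
by exists t; rewrite !inE //; case: lin => ->.
Qed.

(** * Single-peaked orders along an axis *)

Section SinglePeaked.

Variables (T : finType) (lhd succ : rel T).
Hypotheses (lhd_lin : strict_linear_order lhd)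
  (succ_lin : strict_linear_order succ) (sp : single_peaked lhd succ).

(** Unless [y] is the top, it separates the top from [x] or from [z], and beats the one on the far
    side. *)
Lemma single_peaked_no_valley x y z :
  lhd x y -> lhd y z -> succ y x || succ y z.
Proof.
move=> xy yz; have [t top_t] := ex_top y succ_lin.
case: (eqVneq t y) top_t => [->|neq] top_t.
  case/andP: top_t => _ /forall_inP/(_ x (in_setT _)).
  by rewrite (strict_neq lhd_lin xy) /= => ->.
case: lhd_lin => _ _ /(_ _ _ neq)/orP[ty|yt].
  by rewrite (sp top_t (or_intror (conj ty yz))) orbT.
by rewrite (sp top_t (or_introl (conj xy yt))).
Qed.

(** After a descent from [x] to [y], a climb would leave a valley at [y]. So comparing with the
    nearest remaining resource settles a whole side. *)
Lemma single_peaked_right x y z :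
  lhd x y -> lhd y z -> succ x y -> succ x z.
Proof.
move=> xy yz xy'; have [_ tr _] := succ_lin.
have := single_peaked_no_valley xy yz.
by rewrite (negbTE (strict_asym succ_lin xy')) => /(tr _ _ _ xy').
Qed.

Lemma single_peaked_left x y z :
  lhd x y -> lhd y z -> succ z y -> succ z x.
Proof.
move=> xy yz zy; have [_ tr _] := succ_lin.
have := single_peaked_no_valley xy yz.
by rewrite (negbTE (strict_asym succ_lin zy)) orbF => /(tr _ _ _ zy).
Qed.

(** Meant for passing agents: preferring the next resource to her own, such an agent prefers her own
    to all those on its left. *)
Lemma single_peaked_turn x y z :
  lhd x y -> lhd y z -> succ z y -> succ y x.
Proof.
move=> xy yz zy; have := single_peaked_no_valley xy yz.
by rewrite (negbTE (strict_asym succ_lin zy)) orbF.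
Qed.

End SinglePeaked.

(** * Invariants of the procedure and correctness of its verdict *)

Section Correctness.

Variables (n : nat) (I : instance n) (lhd : rel 'I_n).
Hypotheses (lhd_lin : strict_linear_order lhd)
  (sp : single_peaked_instance lhd I).

Local Notation r a := (init I a).
Implicit Types (a b c : 'I_n) (s D : seq 'I_n) (R : {set 'I_n}).

Definition left_of a b := lhd (r a) (r b).

Definition beats_head a D := if D is b :: _ then pref I a (r a) (r b) else true.

Definition weakly_dominates (pi' pi : {perm 'I_n}) :=
  forall a, pref I a (pi' a) (pi a) \/ pi' a = pi a.

Let plin a := pref_linear I a.

Lemma r_neq a b : left_of a b -> r a != r b.
Proof. exact: (strict_neq lhd_lin). Qed.

(** [D] has its latest agent first, so [rev D ++ s] lists the remaining agents from left to
    right. *)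
Record backward_inv s R D : Prop := BackwardInv {
  inv_sorted : pairwise left_of (rev D ++ s);
  inv_remaining : forall a, (r a \in R) = (a \in rev D ++ s);
  inv_passed : forall a b, b \in D -> left_of a b -> pref I b (r b) (r a);
  inv_fixed : forall pi', weakly_dominates pi' (init I) ->
    forall a, r a \notin R -> pi' a = r a
}.

(** Holds whenever the backward loop has stopped. For nonempty [s] it is one half of the swap behind
    a rejection; the value [false] for empty [s] ensures that nobody is left in [D] at the end. *)
Definition head_prefers_next s D :=
  if D is b :: _ then
    if s is c :: _ then pref I b (r c) (r b) else false
  else true.

Definition diver_inv (st : diver_state n) : Prop :=
  match st with
  | Visit s R D _ => backward_inv s R D /\ head_prefers_next s D
  | Backward s R D _ => backward_inv s R D
  | Returned _ PO => pareto_optimal I (init I)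
  | Returned _ NotPO => ~ pareto_optimal I (init I)
  end.

Lemma beats_nextN a s : pairwise left_of (a :: s) ->
  ~~ beats_next I a (r a) s ->
  if s is c :: _ then pref I a (r c) (r a) else false.
Proof.
case: s => [|c s] //= /andP[/andP[ac _] _].
by rewrite (strictN (plin a)) // r_neq.
Qed.

Lemma backward_inv_sorted a s R D : backward_inv (a :: s) R D ->
  [/\ pairwise left_of (a :: s), {in D, forall b, left_of b a}
    & {in s, forall b, left_of a b}].
Proof.
case=> srt _ _ _; move: srt; rewrite pairwise_cat => /and3P[rel_DS _ srt].
split=> // b bin.
  by move/allrelP: rel_DS => /(_ b a); rewrite mem_rev inE eqxx; apply.
by move: srt => /= /andP[/allP/(_ _ bin)].
Qed.

Lemma is_topP a s R D : backward_inv (a :: s) R D ->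
  is_top (pref I a) R (r a) = beats_next I a (r a) s && beats_head a D.
Proof.
move=> inv; have [srt Dl sr] := backward_inv_sorted inv.
have aR : r a \in R by rewrite (inv_remaining inv) mem_cat inE eqxx orbT.
rewrite /is_top aR /=; apply/forall_inP/andP => [top|[nxt hd] x].
  split.
    case: s => [|c s] //= in inv sr srt *.
    have ac : left_of a c by apply: sr; rewrite inE eqxx.
    apply: (implyP (top _ _)); last by rewrite eq_sym r_neq.
    by rewrite (inv_remaining inv) mem_cat !inE eqxx !orbT.
  case: D => [|b D] //= in inv Dl *.
  have ba : left_of b a by apply: Dl; rewrite inE eqxx.
  apply: (implyP (top _ _)); last by rewrite r_neq.
  by rewrite (inv_remaining inv) mem_cat mem_rev !inE eqxx.
(* Every resource is held initially by some agent [c], so the invariant places it in [D] or among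
   the agents to visit. *)
rewrite -[x](permKV (init I)); move: (_ x) => {x}c.
rewrite (inv_remaining inv) mem_cat mem_rev inE => cin; apply/implyP => neq.
have {neq} neq : c != a by apply: contraNneq neq => ->.
case/or3P: cin => [cD|/eqP eca|cs]; last 2 first.
- by rewrite eca eqxx in neq.
- case: s => [|d s] //= in nxt cs srt sr inv *.
  move: cs; rewrite inE => /predU1P[->//|cs].
  have /and3P[_ /allP/(_ _ cs) dc _] := srt.
  by apply: (single_peaked_right lhd_lin (plin a) (@sp a) _ dc nxt);
    apply: sr; rewrite inE eqxx.
case: D => [|d D] //= in hd cD Dl inv *.
move: cD; rewrite inE => /predU1P[->//|cD].
have cd : left_of c d.
  have := inv_sorted inv; rewrite pairwise_cat => /and3P[_ + _].
  rewrite rev_cons pairwise_rcons => /andP[/allP/(_ c) + _].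
  by rewrite mem_rev; apply.
by apply: (single_peaked_left lhd_lin (plin a) (@sp a) cd _ hd);
  apply: Dl; rewrite inE eqxx.
Qed.

(* Everybody who left already is stuck with her resource in a dominating
   allocation, so that an agent holding the best remaining one is stuck too. *)
Lemma top_fixed pi' R a : weakly_dominates pi' (init I) ->
  (forall c, r c \notin R -> pi' c = r c) ->
  is_top (pref I a) R (r a) -> pi' a = r a.
Proof.
move=> dom fixed /andP[_ /forall_inP top].
case: (dom a) => // better; have neq := strict_neq (plin a) better.
have [inR|] := boolP (pi' a \in R).
  by have := implyP (top _ inR) neq; rewrite (negbTE (strict_asym (plin a) better)).
rewrite -[pi' a](permKV (init I)) => /fixed; rewrite permKV => /perm_inj eqa.
by rewrite -[in RHS]eqa permKV.
Qed.

Lemma backward_inv_pick a s R D1 D2 s1 : backward_inv s R D1 ->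
  is_top (pref I a) R (r a) -> {subset D2 <= D1} ->
  rev D1 ++ s = rev D2 ++ a :: s1 ->
  backward_inv s1 (R :\ r a) D2.
Proof.
move=> inv top subD eqE; have [irr _ _] := lhd_lin.
have uE : uniq (rev D1 ++ s).
  by apply: pairwise_uniq (inv_sorted inv) => x; rewrite /left_of irr.
have perE : perm_eq (rev D1 ++ s) (a :: rev D2 ++ s1).
  by rewrite eqE -cat1s perm_catCA.
split.
- apply: subseq_pairwise (inv_sorted inv); rewrite eqE.
  by rewrite cat_subseq // subseq_cons.
- move=> c; rewrite in_setD1 (inj_eq perm_inj) (inv_remaining inv).
  rewrite (perm_mem perE) inE; case: eqP => //= ->.
  by move: uE; rewrite (perm_uniq perE) /= => /andP[/negbTE->].
- by move=> c b /subD; apply: (inv_passed inv).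
move=> pi' dom c; rewrite in_setD1 negb_and negbK.
have fixed := inv_fixed inv dom.
case/orP=> [/eqP/perm_inj ->|]; last exact: fixed.
exact: top_fixed fixed top.
Qed.

Lemma swap_improves a b : pref I a (r b) (r a) -> pref I b (r a) (r b) ->
  ~ pareto_optimal I (init I).
Proof.
move=> ab ba; apply; exists (tperm a b * init I)%g; split; last first.
  by exists a; rewrite permM tpermL.
by move=> c; rewrite permM; case: tpermP => [->|->|_ _]; [left|left|right].
Qed.

Lemma all_fixed_pareto R :
  (forall pi', weakly_dominates pi' (init I) ->
    forall a, r a \notin R -> pi' a = r a) ->
  (forall a, r a \notin R) -> pareto_optimal I (init I).
Proof.
move=> fixed allR [pi' [dom [a]]]; rewrite (fixed _ dom _ (allR a)).
by case: (plin a) => ->.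
Qed.

Lemma diver_inv_step st : diver_inv st -> diver_inv (diver_step I st).
Proof.
case: st => [[|a s] R D lg|s R [|b D] lg|lg v] //=.
- case: D => [|b D] [inv] //= _.
  apply: all_fixed_pareto (inv_fixed inv) _ => a.
  by rewrite (inv_remaining inv).
- case=> inv hd; have [srt Dl sr] := backward_inv_sorted inv.
  case: ifP => [top|ntop]; first exact: (backward_inv_pick inv top).
  case: ifP => [nxt|nnxt] /=.
    (* With [D] empty, beating the next resource would already put [r a] on top; hence there is a
       partner for the swap. *)
    move: ntop; rewrite (is_topP inv) nxt /=.
    case: D => [|b D] //= in inv hd Dl *.
    move/negbT; rewrite strictN //; last first.
      by rewrite eq_sym r_neq // Dl // inE eqxx.
    by move/swap_improves; apply.
  have passes := beats_nextN srt (negbT nnxt); split=> //.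
  have right_a : if s is c :: _ then left_of a c else true.
    by case: (s) sr => // c s' -> //; rewrite inE eqxx.
  split.
  + by rewrite rev_cons cat_rcons (inv_sorted inv).
  + by move=> c; rewrite rev_cons cat_rcons (inv_remaining inv).
  + move=> c b; rewrite inE => /predU1P[->|]; last exact: (inv_passed inv).
    case: (s) passes right_a => // d s' passes right_a ca.
    by apply: (single_peaked_turn lhd_lin (plin a) (@sp a) ca right_a passes).
  exact: (inv_fixed inv).
- move=> inv; have [srt sortedE] : pairwise left_of (b :: s) /\
      {in D, forall c, left_of c b}.
    have := inv_sorted inv; rewrite rev_cons cat_rcons pairwise_cat.
    case/and3P=> /allrelP rel _ ->; split=> // c cD.
    by apply: rel; rewrite ?mem_rev // inE eqxx.
  case: ifP => nxt /=; last by have := beats_nextN srt (negbT nxt).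
  (* Moving [b] from [D] to the front of [s] does not change the list of remaining agents, so a
     backward pick reduces to a pick by a visited agent. *)
  have inv' : backward_inv (b :: s) R D.
    split; last exact: (inv_fixed inv).
    + by have := inv_sorted inv; rewrite rev_cons cat_rcons.
    + by move=> a; rewrite (inv_remaining inv) rev_cons cat_rcons.
    by move=> a c cD; apply: (inv_passed inv); rewrite inE cD orbT.
  (* Having passed, [b] beats everything on her left, so the comparison with the next resource
     suffices. *)
  apply: (backward_inv_pick inv') => //.
  rewrite (is_topP inv') nxt /=; case: (D) sortedE inv => //= d D' sE inv.
  by apply: (inv_passed inv); [rewrite inE eqxx | apply: sE; rewrite inE eqxx].
Qed.

End Correctness.

(* Registers: 1 position on the axis, 2 whether the axis goes on at that
   position, 3 and 4 the current agent and her resource, 5 the next resource,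
   6 whether 4 beats 5, 7 the length of D, 8 and 9 the head of D and her
   resource, 10 outcome of a comparison, 11 whether the backward loop goes on.
   Array 2 is the inverse of array 1; array 3 stores D, its head at index
   [size D] and its end at index 1. *)
Definition fill_body : program :=
  [:: Fetch 4 1 1; Store 2 4 1; Incr 1; Less 2 1 0].

Definition backward_body : program :=
  [:: Fetch 8 3 7; Fetch 9 1 8; Prefers 10 8 9 5; If 2 [::] [:: Const 10 1];
      If 10 [:: EmitPick 8 9; Decr 7; Copy 11 7] [:: Const 11 0]].

Definition visit_body : program :=
  [:: Fetch 4 0 1; Fetch 3 2 4; Incr 1; Fetch 5 0 1; Less 2 1 0;
      Prefers 6 3 4 5; If 2 [::] [:: Const 6 1];
      If 6
        [:: Const 10 1;
            If 7 [:: Fetch 8 3 7; Fetch 9 1 8; Prefers 10 3 4 9] [::];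
            If 10 [:: EmitPick 3 4; Copy 11 7; While 11 backward_body]
                  [:: Return NotPO]]
        [:: Incr 7; Store 3 7 3; EmitPass 3]].

Definition sweep : program := [:: While 2 visit_body; Return PO].

Definition diver_program : program :=
  [:: Less 2 1 0, While 2 fill_body, Const 1 0, Less 2 1 0 & sweep].

Arguments upd T f k v j /.

(** * Linear-time simulation of the procedure by the machine *)

Section Simulation.

Variables (n : nat) (I : instance n) (lhd : rel 'I_n).
Hypotheses (lhd_lin : strict_linear_order lhd)
  (sp : single_peaked_instance lhd I).

Local Notation r a := (init I a).
Implicit Types (a b c : 'I_n) (s D : seq 'I_n) (R : {set 'I_n}).
Implicit Types (g : nat -> nat) (m : nat -> nat -> nat) (P : ram_state -> Prop).

Local Notation step := (ram_step (prefers_nat I)).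

(** A bound rather than an exact count, as the branches of the program differ in length. *)
Definition leads k P (st : ram_state) := exists2 t, t <= k & P (iter t step st).

Lemma leads0 k P st : P st -> leads k P st.
Proof. by exists 0. Qed.

Lemma leadsS k P st : leads k P (step st) -> leads k.+1 P st.
Proof. by case=> t tk Pt; exists t.+1; rewrite ?iterSr. Qed.

Lemma leads_trans k1 k2 P st : leads k1 (leads k2 P) st -> leads (k1 + k2) P st.
Proof.
by case=> t1 le1 [t2 le2 Pt]; exists (t2 + t1); rewrite ?iterD // addnC leq_add.
Qed.

Lemma leadsW k1 k2 P1 P2 st : k1 <= k2 -> (forall st, P1 st -> P2 st) ->
  leads k1 P1 st -> leads k2 P2 st.
Proof. by move=> le12 P12 [t le1 /P12]; exists t => //; apply: leq_trans le12. Qed.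

Lemma prefers_natE a (x y : 'I_n) : prefers_nat I a x y = pref I a x y.
Proof. by rewrite /prefers_nat !valK. Qed.

Fixpoint stored (arr : nat -> nat) D :=
  if D is b :: D' then arr (size D) = b /\ stored arr D' else True.

Lemma eq_stored arr1 arr2 D : (forall k, k <= size D -> arr1 k = arr2 k) ->
  stored arr1 D -> stored arr2 D.
Proof.
elim: D => //= b D IH eqarr [<- /IH-IHD]; split; first by rewrite eqarr.
by apply: IHD => k kD; apply: eqarr; apply: leqW.
Qed.

(** [layout_axis] extends past the end of the axis, where both sides are 0, so that the next
    resource can be fetched even for the last agent. *)
Record layout s D g m : Prop := Layout {
  layout_size : g 0 = n;
  layout_pos : g 1 + size s = n;
  layout_more : g 2 = (0 < size s);
  layout_depth : g 7 = size D;
  layout_axis : forall k, m 0 (g 1 + k) = nth 0 [seq val (r a) | a <- s] k;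
  layout_held : forall a, m 1 a = r a;
  layout_holder : forall a, m 2 (r a) = a;
  layout_stack : stored (m 3) D
}.

(** [R] has no counterpart in the machine: [is_topP] replaces the test on it by two comparisons. *)
Definition matches (st : diver_state n) (st' : ram_state) : Prop :=
  match st with
  | Visit s R D lg => exists g m,
      layout s D g m /\ st' = Running sweep g m lg
  | Backward s R D lg => exists g m,
      [/\ layout s D g m, g 5 = nth 0 [seq val (r a) | a <- s] 0,
          g 11 = size D & st' = Running (While 11 backward_body :: sweep) g m lg]
  | Returned lg v => st' = Halted lg v
  end.

(** The weight 3 of a visit pays for the entry of [D] made by a pass or for the start of a backward
    loop; the offsets pay for leaving that loop and for the final return. *)
Definition potential (st : diver_state n) : nat :=
  match st with
  | Visit s _ D _ => 3 * size s + size D + 1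
  | Backward s _ D _ => 3 * size s + size D + 2
  | Returned _ _ => 0
  end.

Lemma potential_step st : 0 < potential st ->
  potential (diver_step I st) < potential st.
Proof.
case: st => [[|a s] R D lg|s R [|b D] lg|lg v] //= _;
  do ?case: ifP => _ //=; lia.
Qed.

(** For empty [s] the comparison is made with the default 0, and its outcome is then overwritten by
    1, as the convention for the last agent demands. *)
Lemma leads_beats x ra rr a s k P q g m lg : x != 2 ->
  g 2 = (0 < size s) -> g 5 = nth 0 [seq val (r c) | c <- s] 0 ->
  g ra = a -> g rr = r a ->
  (forall g', g' x = beats_next I a (r a) s ->
     (forall j, j != x -> g' j = g j) -> leads k P (Running q g' m lg)) ->
  leads k.+3 P
    (Running [:: Prefers x ra rr 5, If 2 [::] [:: Const x 1] & q] g m lg).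
Proof.
move=> x2 more next gra grr cont; do 2!apply: leadsS => /=.
rewrite gra grr next [2 == x]eq_sym (negbTE x2) more.
case: (s) cont => [|c s'] /= cont; last apply: leadsW (leqnSn k) (fun _ => id) _.
  by apply: leadsS => /=; apply: cont => [|j /negbTE /= ->]; rewrite /= ?eqxx.
by apply: cont => [|j /negbTE /= ->]; rewrite /= ?eqxx ?prefers_natE.
Qed.

(** 18 is the length of the longest path: a pick by the last agent with [D] nonempty, from the test
    of the outer loop to the [Copy] before the backward loop. *)
Lemma matches_step st st' : diver_inv I lhd st -> matches st st' ->
  0 < potential st -> leads 18 (matches (diver_step I st)) st'.
Proof.
case: st => [[|a s] R D lg|s R [|b D] lg|lg v] //=.
- move=> _ [g [m [lay ->]]] _; have more := layout_more lay.
  by apply: leadsS; rewrite /= more /=; apply: leadsS; apply: leads0.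
- case=> inv _ [g [m [lay ->]]] _; rewrite (is_topP lhd_lin sp inv).
  case: lay => /= gn pos more depth axis held holder stack.
  have r_a : m 0 (g 1) = r a by have := axis 0; rewrite addn0.
  have axis' k : m 0 ((g 1).+1 + k) = nth 0 [seq val (r a) | a <- s] k.
    by rewrite addSnnS axis.
  have next : m 0 (g 1).+1 = nth 0 [seq val (r a) | a <- s] 0.
    by rewrite -axis' addn0.
  have more' : ((g 1).+1 < g 0) = (0 < size s) by lia.
  apply: leadsS; rewrite /= more /=.
  do 5!apply: leadsS => /=; rewrite r_a holder next more'.
  apply: (@leads_beats _ _ _ a s) => //= g' beats g'E.
  apply: leadsS; rewrite /= beats eqb0 negbK; case: beats_next => /=; last first.
    do 3!apply: leadsS => /=; apply: leads0; rewrite !g'E //=.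
    eexists; eexists; split; last reflexivity.
    split; rewrite /= ?g'E //= ?depth //; first by rewrite addSnnS.
    split; first by rewrite eqxx.
    by apply: eq_stored stack => k kD /=; rewrite ltn_eqF.
  apply: leadsS => /=; apply: leadsS; rewrite /= g'E //= depth.
  (* Shared by the cases of empty and nonempty [D], which differ only in registers 8 to 10. *)
  have visit_rest g'' : g'' 10 = beats_head I a D ->
      (forall j, j < 8 -> g'' j = g' j) ->
      leads 3 (matches
       (if beats_head I a D
        then Backward s (R :\ r a) D (rcons lg (Defs.Pick a (r a)))
        else Returned n lg NotPO))
      (Running
        [:: If 10 [:: EmitPick 3 4; Copy 11 7; While 11 backward_body]
              [:: Return NotPO] & sweep] g'' m lg).
    move=> hd g''E; apply: leadsS; rewrite /= hd eqb0 negbK; case: beats_head => /=; last first.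
      by apply: leadsS; apply: leads0.
    do 2!apply: leadsS => /=; apply: leads0; rewrite !g''E // !g'E //=.
    eexists; eexists; split; last reflexivity; rewrite /= ?g''E // ?g'E //=.
    by split; rewrite /= ?g''E // ?g'E //= addSnnS.
  case: D => [|b D] //= in depth stack visit_rest inv *.
    apply: leadsW (visit_rest _ _ _) => //.
    by move=> j j8 /=; rewrite (ltn_eqF (leq_trans j8 _)).
  case: stack => top_b _; do 3!apply: leadsS => /=.
  rewrite !g'E //= depth top_b held prefers_natE.
  apply: (leadsW _ _ (visit_rest _ _ _)) => //= j j8.
  by rewrite !(ltn_eqF (leq_trans j8 _)).
- move=> inv [g [m [lay next loop ->]]] _.
  apply: leadsS; rewrite /= loop; apply: leads0; exists g, m; split=> //.
move=> inv [g [m [[gn pos more depth axis held holder stack] next loop ->]]] _.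
case: stack => /= top_b stack.
apply: leadsS; rewrite /= loop; do 2!apply: leadsS => /=.
rewrite depth top_b held.
apply: (@leads_beats _ _ _ b s) => //= g' beats g'E.
apply: leadsS; rewrite /= beats eqb0 negbK; case: beats_next => /=.
  do 3!apply: leadsS => /=; apply: leads0; rewrite !g'E //=.
  eexists; eexists; split; last reflexivity; rewrite /= ?g'E ?depth //=.
  by split; rewrite /= ?g'E ?depth.
do 2!apply: leadsS => /=; apply: leads0.
eexists; eexists; split; last reflexivity.
by split; rewrite /= ?g'E ?depth.
Qed.

Lemma matches_run st st' : diver_inv I lhd st -> matches st st' ->
  exists lg v, [/\ exists k, iter k (diver_step I) st = Returned n lg v,
    leads (18 * potential st) (eq^~ (Halted lg v)) st'
    & diver_inv I lhd (Returned n lg v)].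
Proof.
have [p] := ubnP (potential st); elim: p st st' => // p IH st st' lt_p inv mat.
have [pot0|pot] := posnP (potential st).
  case: st pot0 inv mat {lt_p} => [s R D lg|s R D lg|lg v] /=; try lia.
  by move=> _ inv ->; exists lg, v; split=> //; [exists 0 | apply: leads0].
have dec := potential_step pot.
have [t t18 mat'] := matches_step inv mat pot.
have [|lg [v [[k run] ram inv']]] :=
  IH _ _ (leq_trans dec _) (diver_inv_step lhd_lin sp inv) mat'; first by lia.
exists lg, v; split=> //; first by exists k.+1; rewrite iterSr.
have le : 18 + 18 * potential (diver_step I st) <= 18 * potential st by lia.
by apply: (leadsW le (fun _ => id)); apply: leads_trans; exists t.
Qed.

(** Each agent costs the loop test and the four instructions of the body; one more test leaves the
    loop. *)
Lemma leads_fill k K P q g m lg :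
  g 0 = n -> g 1 + k = n -> g 2 = (0 < k) ->
  (forall a, m 1 a = r a) -> (forall a, a < g 1 -> m 2 (r a) = a) ->
  (forall g' m', g' 0 = n -> g' 7 = g 7 -> m' 0 = m 0 -> m' 1 = m 1 ->
     (forall a, m' 2 (r a) = a) -> leads K P (Running q g' m' lg)) ->
  leads (5 * k + K.+1) P (Running (While 2 fill_body :: q) g m lg).
Proof.
elim: k g m => [|k IH] g m g0 g1 more held holder cont.
  apply: leadsS; rewrite /= more /=; apply: cont => // a.
  by apply: holder; rewrite -(addn0 (g 1)) g1.
have lt1 : g 1 < n by lia.
rewrite mulnS -addnA; apply: leadsS; rewrite /= more /=.
have m1 : m 1 (g 1) = r (Ordinal lt1) by rewrite -held.
do 4!apply: leadsS => /=; rewrite m1.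
apply: IH => //=; rewrite ?g0 ?addSnnS //.
- by congr nat_of_bool; lia.
- move=> a le_a; rewrite val_eqE (inj_eq perm_inj) -val_eqE /=.
  by case: eqP => // ne; apply: holder; lia.
Qed.

(** The procedure sorts agents while the machine is given sorted resources. The two agree because a
    total antisymmetric order sorts a list in only one way. *)
Lemma start_order : let L := sort (fun a b => axis_le lhd (r a) (r b)) (enum 'I_n) in
  [/\ pairwise (left_of I lhd) L, perm_eq L (enum 'I_n)
    & [seq r a | a <- L] = sort (axis_le lhd) (enum 'I_n)].
Proof.
have [irr tr tot] := lhd_lin.
have le_tr : transitive (axis_le lhd).
  rewrite /axis_le => y x z /predU1P[->//|xy] /predU1P[<-|yz].
    by rewrite xy orbT.
  by rewrite (tr _ _ _ xy yz) orbT.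
have le_tot : total (axis_le lhd).
  rewrite /axis_le => x y; case: eqVneq => //= /tot/orP[->//|->].
  by rewrite !orbT.
have le_anti : antisymmetric (axis_le lhd).
  rewrite /axis_le => x y /andP[/predU1P[//|xy]] /predU1P[//|yx].
  by have := strict_asym lhd_lin xy; rewrite yx.
move=> L; have permL : perm_eq L (enum 'I_n) by rewrite perm_sort.
split=> //; last first.
  have -> : [seq r a | a <- L] = sort (axis_le lhd) [seq r a | a <- enum 'I_n].
    by rewrite sort_map.
  apply/perm_sortP => //.
  apply: uniq_perm; [|exact: enum_uniq|].
    by rewrite map_inj_uniq ?enum_uniq //; apply: perm_inj.
  move=> x; rewrite mem_enum; apply/mapP; exists ((init I)^-1%g x).
    by rewrite mem_enum.
  by rewrite permKV.
have: uniq L by rewrite (perm_uniq permL) enum_uniq.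
rewrite uniq_pairwise => uL.
have: pairwise (fun a b => axis_le lhd (r a) (r b)) L.
  rewrite -sorted_pairwise; last by move=> b a c; apply: le_tr.
  by apply: sort_sorted => a b; apply: le_tot.
(* Distinctness turns the reflexive order of the sort into the strict one. *)
move=> sL; have: pairwise [rel a b | (a != b) && axis_le lhd (r a) (r b)] L.
  by rewrite pairwise_relI uL.
apply: sub_pairwise => a b /= /andP[ne /predU1P[/perm_inj eq_ab|//]].
by rewrite eq_ab eqxx in ne.
Qed.

Lemma diver_start_inv : diver_inv I lhd (diver_start I lhd).
Proof.
have [sL pL _] := start_order; split=> //; split=> //= [a|? _ a].
  by rewrite inE (perm_mem pL) mem_enum.
by rewrite inE.
Qed.

Lemma potential_start : potential (diver_start I lhd) = 3 * n + 1.
Proof. by rewrite /= size_sort size_enum_ord addn0. Qed.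

Lemma ram_start_matches :
  leads (5 * n + 5) (matches (diver_start I lhd)) (ram_start I lhd diver_program).
Proof.
have [_ pL mapL] := start_order.
have -> : 5 * n + 5 = (5 * n + 4).+1 by rewrite addnS.
apply: leadsS => /=; apply: leads_fill => //= [a|g' m' g'0 g'7 m'0 m'1 m'2].
  rewrite (nth_map a) ?size_enum_ord //; congr (val (r _)).
  by apply: val_inj; rewrite /= nth_enum_ord.
do 2!apply: leadsS => /=; apply: leads0; eexists; eexists; split; last reflexivity.
split; rewrite //= ?size_sort ?size_enum_ord ?g'0 //.
- by move=> k; rewrite m'0 add0n -mapL -map_comp.
by move=> a; rewrite m'1 (nth_map a) ?size_enum_ord // nth_ord_enum.
Qed.

End Simulation.

Theorem theorem1 :
  exists (p : program) (C : nat),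
  forall (n : nat) (I : instance n) (lhd : rel 'I_n),
    strict_linear_order lhd ->
    single_peaked_instance lhd I ->
    exists (lg : seq event) (v : verdict) (t : nat),
      [/\ diver_returns I lhd lg v,
          ram_returns_in I lhd p t lg v,
          0 < n -> t <= C * n,
          pareto_optimal I (init I) -> v = PO
        & ~ pareto_optimal I (init I) -> v = NotPO].
Proof.
(* Setup and simulation take at most 5n + 5 + 18(3n + 1) = 59n + 23 steps, which is at most 82n for
   n > 0. *)
exists diver_program, 82 => n I lhd lhd_lin sp.
have [t1 t1_le mat] := ram_start_matches I lhd_lin.
have inv := diver_start_inv I lhd_lin.
have [lg [v [run [t2 t2_le ram] verdictP]]] := matches_run lhd_lin sp inv mat.
move: t2_le; rewrite potential_start => t2_le.
exists lg, v, (t2 + t1); split=> //; first by rewrite /ram_returns_in iterD.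
- by lia.
- by case: v verdictP {run ram}.
by case: v verdictP {run ram}.
Qed.
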